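(* Let $\Delta$ be a simplicial complex whose (finite) vertex set is bipartitioned into two sets $\mathfrak{L}$ and $\mathfrak{R}$ (either of which may be empty). Then there exist two SP-games $(R_1,B)$ and $(R_2,B)$ such that (a) $\Delta=\Delta_{R_1,B}$ and (b) $\Delta=\Gamma_{R_2,B}$, and in both cases the set of Left (respectively Right) basic positions is $\mathfrak{L}$ (respectively $\mathfrak{R}$).
   Context: A board is a finite graph. A ruleset $R$ specifies which pieces each of the two players, Left and Right, may place (each piece occupies a non-empty collection of vertices of the board) and which placements are legal; $(R,B)$ denotes the game with ruleset $R$ played on board $B$. A position is a configuration of pieces on the board. A basic position is the board with exactly one piece placed (a Left or Right basic position according to who owns the piece). A position is legal if it can be reached from the empty board by a sequence of legal moves, and illegal otherwise. A strong placement game (SP-game) is a combinatorial game (two players, perfect information, no chance, no simultaneous moves) such that: (i) the board is empty at the beginning; (ii) players place pieces on empty spaces of the board according to the rules; (iii) pieces are not moved or removed once placed; (iv) if a position can be reached through a sequence of legal moves, then any sequence of moves leading to this position consists of legal moves. Hence a position is identified with the set of basic positions it is made of, and every subset of a legal position is legal. The legal complex $\Delta_{R,B}$ is the simplicial complex whose vertex set is the set of all basic positions and whose faces are the legal positions. The illegal complex $\Gamma_{R,B}$ is the simplicial complex whose vertex set is the set of all basic positions and whose facets are the minimal illegal positions (illegal positions all of whose proper subsets are legal). Elements of the vertex set need not be faces. The empty complex (no non-empty faces) is not distinguished from $\{\emptyset\}$; in particular, if there are no illegal positions the illegal complex is the empty complex. Equality of $\Delta$ with a game complex means equality after identifying the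 vertices of $\Delta$ with the basic positions, with $\mathfrak{L}$ corresponding to Left and $\mathfrak{R}$ to Right basic positions. *)

(* Defs.v *)
From mathcomp Require Import all_boot.

Set Implicit Arguments.
Unset Strict Implicit.
Unset Printing Implicit Defensive.

(** * Simplicial complexes *)

(* Vertices need not be faces.  The family of faces may be empty: the void
   family and [[set set0]] are both allowed, and are identified by comparing
   complexes on their non-empty faces only (see [same_complex] below). *)
Record complex (V : finType) := Complex {
  faces :> {set {set V}};
  faces_closed : forall s t : {set V}, s \in faces -> t \subset s -> t \in faces
}.

Definition facets (V : finType) (D : complex V) : {set {set V}} :=
  [set s | maxset [pred t in faces D] s].

Lemma generated_closed (V : finType) (F : {set {set V}}) (s t : {set V}) :
  s \in [set u : {set V} | [exists f in F, u \subset f]] -> t \subset s ->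
  t \in [set u : {set V} | [exists f in F, u \subset f]].
Proof.
rewrite !inE => /exists_inP[f fF sf] ts; apply/exists_inP; exists f => //.
exact: subset_trans ts sf.
Qed.

(* When F is an antichain, its members are exactly the facets. *)
Definition generated_complex (V : finType) (F : {set {set V}}) : complex V :=
  Complex (@generated_closed V F).

(** * Boards and rulesets *)

Record board := Board {
  space :> finType;
  adj : rel space;
  adj_sym : symmetric adj;
  adj_irrefl : irreflexive adj
}.

Inductive player := Left | Right.

(* [piece] lists the kinds of pieces; [spots k] is the collection of vertex
   sets that a piece of kind [k] may cover when put on the board. *)
Record pieces (B : board) := Pieces {
  piece : finType;
  owner : piece -> player;
  spots : piece -> {set {set B}};
  spots_neq0 : forall k : piece, set0 \notin spots k
}.

(* A basic position is one piece together with the vertices it occupies. *)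
Definition basic (B : board) (K : pieces B) : finType :=
  {x : piece K * {set B} | x.2 \in spots x.1}.

Definition basic_owner (B : board) (K : pieces B) (b : basic K) : player :=
  owner (val b).1.

Definition cells (B : board) (K : pieces B) (b : basic K) : {set B} :=
  (val b).2.

(* Arbitrary configurations, possibly illegal ones (e.g. overlapping pieces). *)
Definition position (B : board) (K : pieces B) : finType := {set (basic K)}.

Definition occupied (B : board) (K : pieces B) (P : position K) : {set B} :=
  \bigcup_(b in P) cells b.

(* [move p P Q]: player [p] is allowed to move from [P] to [Q].  Nothing forces
   a move of a general ruleset to be the placement of a piece. *)
Record ruleset (B : board) := Ruleset {
  rule_pieces :> pieces B;
  start : position rule_pieces;
  move : player -> rel (position rule_pieces)
}.

(* The two players need not alternate. *)
Definition legal (B : board) (R : ruleset B) (P : position R) : bool :=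
  connect [rel P Q | move Left P Q || move Right P Q] (start R) P.

Fixpoint legal_sequence (B : board) (R : ruleset B) (P : position R)
    (s : seq (basic R)) : bool :=
  if s is b :: s' then
    move (basic_owner b) P (b |: P) && legal_sequence (b |: P) s'
  else true.

(** * Strong placement games *)

Record sp_game (B : board) := SPGame {
  sp_rules :> ruleset B;
  sp_start : start sp_rules = set0;
  sp_place : forall (p : player) (P Q : position sp_rules),
    legal P -> move p P Q ->
    exists b : basic sp_rules,
      [/\ basic_owner b = p, Q :\: P = [set b]
        & [disjoint cells b & occupied P]];
  sp_keep : forall (p : player) (P Q : position sp_rules),
    legal P -> move p P Q -> P \subset Q;
  (* A sequence of moves leading to P is an ordering of the pieces of P. *)
  sp_order : forall (P : position sp_rules) (s : seq (basic sp_rules)),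
    legal P -> uniq s -> [set b in s] = P -> legal_sequence set0 s
}.

Definition left_basic (B : board) (G : sp_game B) : {set basic G} :=
  [set b | if basic_owner b is Left then true else false].

Definition right_basic (B : board) (G : sp_game B) : {set basic G} :=
  [set b | if basic_owner b is Right then true else false].

Lemma legal_sequence_cat (B : board) (R : ruleset B) (s1 s2 : seq (basic R))
    (P : position R) :
  legal_sequence P (s1 ++ s2) -> legal P -> legal (P :|: [set b in s1]).
Proof.
elim: s1 P => [|b s1 IH] P /=.
  by move=> _ lP; rewrite (_ : [set b in [::]] = set0) ?setU0 //; apply/setP=> x; rewrite !inE.
case/andP=> mv rest lP.
have -> : P :|: [set x in b :: s1] = (b |: P) :|: [set x in s1].
  by apply/setP=> x; rewrite !inE orbCA orbA.
apply: IH => //; apply: connect_trans lP _; apply: connect1 => /=.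
by move: mv; case: (basic_owner b) => ->; rewrite ?orbT.
Qed.

Lemma legal_subset (B : board) (G : sp_game B) (P Q : position G) :
  P \in [set S : position G | legal S] -> Q \subset P ->
  Q \in [set S : position G | legal S].
Proof.
rewrite !inE => lP QP.
have us : uniq (enum Q ++ enum (P :\: Q)).
  rewrite cat_uniq !enum_uniq andbT /=; apply/hasPn=> x.
  by rewrite !mem_enum inE => /andP[].
have es : [set b in enum Q ++ enum (P :\: Q)] = P.
  apply/setP=> x; rewrite inE mem_cat !mem_enum inE.
  by case: (boolP (x \in Q)) => // /(subsetP QP) ->.
have := legal_sequence_cat (sp_order lP us es).
rewrite /legal sp_start connect0 => /(_ isT).
by rewrite set0U (_ : [set b in enum Q] = Q) //; apply/setP=> x; rewrite inE mem_enum.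
Qed.

Definition legal_complex (B : board) (G : sp_game B) : complex (basic G) :=
  Complex (@legal_subset B G).

Definition minimal_illegal (B : board) (G : sp_game B) : {set position G} :=
  [set P | minset [pred S : position G | ~~ legal S] P].

Definition illegal_complex (B : board) (G : sp_game B) : complex (basic G) :=
  generated_complex (minimal_illegal G).

Lemma facets_illegal_complex (B : board) (G : sp_game B) :
  facets (illegal_complex G) = minimal_illegal G.
Proof.
apply/setP=> P; rewrite inE; apply/maxsetP/idP => /=.
  rewrite inE => -[/exists_inP[Q Qm PQ] maxP].
  rewrite -(maxP Q) //= inE; by apply/exists_inP; exists Q.
move=> Pm; split=> [|Q]; first by rewrite inE; apply/exists_inP; exists P.
rewrite inE => /exists_inP[S Sm QS] PQ.
apply/eqP; rewrite eqEsubset PQ andbT (subset_trans QS) //.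
move: Pm Sm; rewrite !inE => /minsetP[nP _] /minsetP[_ minS].
by rewrite (minS P nP (subset_trans PQ QS)).
Qed.

(** * Equality of complexes up to renaming the vertices *)

Definition same_complex (V W : finType) (f : V -> W)
    (D : complex V) (E : complex W) : Prop :=
  forall s : {set V}, s != set0 -> (s \in faces D) = (f @: s \in faces E).

Definition is_game_complex (V : finType) (D : complex V) (L R : {set V})
    (B : board) (G : sp_game B) (E : complex (basic G)) : Prop :=
  exists f : V -> basic G,
    [/\ bijective f, f @: L = left_basic G, f @: R = right_basic G
      & same_complex f D E].

(* Main.v *)
(* Take one board vertex per vertex of [D], and one kind of piece per vertex [v],
   which can only be put on the vertex [v] of the board.  Pieces then never
   overlap, so any complex [E] on [V] is realised as a legal complex by allowing
   exactly the placements that lead to a face of [E].  For (a) take [E := D]; for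
   (b) let the faces of [E] be the sets that contain no non-empty facet of [D]:
   the minimal illegal positions are then the non-empty facets of [D]. *)
Require Import Defs.
From mathcomp Require Import all_boot.

Set Implicit Arguments.
Unset Strict Implicit.
Unset Printing Implicit Defensive.

(** * Board and pieces with one dot per vertex *)

Section DotGame.

Context (V : finType) (L : {set V}).

Lemma no_adj_sym : symmetric (fun _ _ : V => false).
Proof. by []. Qed.

Lemma no_adj_irrefl : irreflexive (fun _ _ : V => false).
Proof. by []. Qed.

Definition dot_board : board := Board no_adj_sym no_adj_irrefl.

Lemma dot_spots_neq0 (v : V) : (set0 : {set dot_board}) \notin [set [set v]].
Proof. by rewrite inE eq_sym -card_gt0 cards1. Qed.

Definition dot_pieces : pieces dot_board :=
  @Pieces dot_board V (fun v => if v \in L then Left else Right)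
    (fun v => [set [set v]]) dot_spots_neq0.

Definition dot (v : V) : basic dot_pieces :=
  exist (fun x : V * {set V} => x.2 \in [set [set x.1]]) (v, [set v]) (set11 _).

Definition undot (b : basic dot_pieces) : V := (val b).1.

Lemma dotK : cancel dot undot.
Proof. by []. Qed.

(** The kind [v] has [[set v]] as its only spot, so the piece determines the basic position. *)
Lemma undotK : cancel undot dot.
Proof.
case=> -[v s] sv; apply: val_inj; congr (v, _).
by have /set1P := sv.
Qed.

Lemma dot_bij : bijective dot.
Proof. exact: Bijective dotK undotK. Qed.

Lemma cells_dot (b : basic dot_pieces) : cells b = [set undot b].
Proof. by rewrite -[b]undotK. Qed.

Lemma dot_imK (s : {set V}) : undot @: (dot @: s) = s.
Proof. by rewrite -imset_comp (eq_imset _ dotK) imset_id. Qed.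

Lemma undot_imK (P : {set basic dot_pieces}) : dot @: (undot @: P) = P.
Proof. by rewrite -imset_comp (eq_imset _ undotK) imset_id. Qed.

Lemma basic_owner_dot (v : V) :
  basic_owner (dot v) = if v \in L then Left else Right.
Proof. by []. Qed.

(** Distinct basic positions cover distinct single vertices. *)
Lemma disjoint_cells_occupied (b : basic dot_pieces) (P : position dot_pieces) :
  b \notin P -> [disjoint cells b & occupied P].
Proof.
move=> bP; rewrite cells_dot disjoints1; apply/bigcupP => -[c cP].
by rewrite cells_dot inE => /eqP /(can_inj undotK) bc; rewrite bc cP in bP.
Qed.

Definition same_player (p q : player) : bool :=
  match p, q with Left, Left | Right, Right => true | _, _ => false end.

Lemma same_playerP (p q : player) : reflect (p = q) (same_player p q).
Proof. by case: p; case: q; constructor. Qed.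

(** * The game whose non-empty legal positions are the faces of [E] *)

Context (E : complex V).

Definition dot_move (p : player) : rel (position dot_pieces) :=
  fun P Q => [exists b, [&& same_player (basic_owner b) p, b \notin P,
    Q == b |: P & undot @: Q \in faces E]].

Definition dot_rules : ruleset dot_board := Ruleset set0 dot_move.

Lemma dot_moveP (p : player) (P Q : position dot_pieces) :
  reflect (exists b, [/\ basic_owner b = p, b \notin P, Q = b |: P
                       & undot @: Q \in faces E]) (dot_move p P Q).
Proof.
apply: (iffP existsP) => -[b].
  by case/and4P => /same_playerP ? ? /eqP ? ?; exists b.
by case=> /same_playerP ? ? /eqP ? ?; exists b; apply/and4P.
Qed.

(** The first disjunct matters when [E] is void: the empty board is legal although [set0] is not a
    face. *)
Lemma legal_dot (P : position dot_rules) :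
  legal P = (P == set0) || (undot @: P \in faces E).
Proof.
apply/idP/idP => [/connectP[s] | ].
  (* Every move tests its target, so the last move of the path shows that [P] is a face. *)
  case: (lastP s) => [_ -> | {}s Q]; first by rewrite eqxx.
  rewrite rcons_path last_rcons => /andP[_ mvQ] ->.
  by case/orP: mvQ => /dot_moveP[b [_ _ _ ->]]; rewrite orbT.
case/orP => [/eqP-> | ]; first exact: connect0.
(* Induction on the number of pieces: closure keeps [P] a face when a piece [b] is removed, and
   putting [b] back is a move. *)
elim: {P}_.+1 {-2}P (ltnSn #|P|) => // n IH P.
case: (set_0Vmem P) => [-> _ _ | [b bP]]; first exact: connect0.
rewrite (cardsD1 b) bP ltnS => Pn PE.
have {}IH : legal (P :\ b : position dot_rules).
  by apply: IH => //; apply: faces_closed PE _; apply/imsetS/subsetDl.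
apply: connect_trans IH _; apply: connect1 => /=.
have : dot_move (basic_owner b) (P :\ b) P.
  by apply/dot_moveP; exists b; rewrite setD11 setD1K.
by case: (basic_owner b) => ->; rewrite ?orbT.
Qed.

(** Each intermediate position is a subset of the final one, hence a face. The start [P] is
    arbitrary so that the induction on [s] goes through. *)
Lemma legal_sequence_dot (P : position dot_rules) (s : seq (basic dot_rules)) :
  uniq s -> [disjoint P & s] -> undot @: (P :|: [set b in s]) \in faces E ->
  legal_sequence P s.
Proof.
elim: s P => //= b s IH P /andP[bs us].
rewrite disjoint_sym disjoint_cons => /andP[bP sP].
have -> : P :|: [set x in b :: s] = (b |: P) :|: [set x in s].
  by apply/setP=> x; rewrite !inE orbCA orbA.
move=> PE; apply/andP; split.
  apply/dot_moveP; exists b; split=> //.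
  by apply: faces_closed PE _; apply/imsetS/subsetUl.
apply: IH => //; rewrite disjoint_sym disjoint_has; apply/hasPn => x xs.
rewrite !inE negb_or; apply/andP; split.
  by apply: contraNneq bs => <-.
by rewrite (disjointFr sP xs).
Qed.

Lemma dot_place (p : player) (P Q : position dot_rules) :
  legal P -> move p P Q ->
  exists b : basic dot_rules,
    [/\ basic_owner b = p, Q :\: P = [set b] & [disjoint cells b & occupied P]].
Proof.
move=> _ /dot_moveP[b [bp bP -> _]]; exists b; split=> //.
  rewrite setDUl setDv setU0; apply/setDidPl.
  by rewrite disjoints1.
exact: disjoint_cells_occupied.
Qed.

Lemma dot_keep (p : player) (P Q : position dot_rules) :
  legal P -> move p P Q -> P \subset Q.
Proof. by move=> _ /dot_moveP[b [_ _ -> _]]; apply: subsetUr. Qed.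

Lemma dot_order (P : position dot_rules) (s : seq (basic dot_rules)) :
  legal P -> uniq s -> [set b in s] = P -> legal_sequence set0 s.
Proof.
rewrite legal_dot => lP us sP; case/orP: lP => [/eqP P0 | PE].
  (* An empty position leaves only the empty sequence, even if [set0] is not a face. *)
  case: s sP {us} => //= b s sP.
  by have := in_set0 b; rewrite -P0 -sP inE mem_head.
apply: legal_sequence_dot => //; last by rewrite set0U sP.
by apply/pred0P => x; rewrite /= inE.
Qed.

Definition dot_game : sp_game dot_board :=
  @SPGame dot_board dot_rules erefl dot_place dot_keep dot_order.

Lemma dot_left : dot @: L = left_basic dot_game.
Proof.
apply/setP=> b; rewrite -[b]undotK (mem_imset _ _ (can_inj dotK)) !inE.
by rewrite basic_owner_dot; case: ifP.
Qed.

Lemma dot_right : dot @: (~: L) = right_basic dot_game.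
Proof.
apply/setP=> b; rewrite -[b]undotK (mem_imset _ _ (can_inj dotK)) !inE.
by rewrite basic_owner_dot; case: ifP.
Qed.

Lemma dot_legal_complex : same_complex dot E (legal_complex dot_game).
Proof.
by move=> s s0; rewrite inE legal_dot imset_eq0 (negPf s0) dot_imK.
Qed.

End DotGame.

(** * Facets as minimal illegal positions *)

Section NonFacets.

Context (V : finType) (D : complex V).

(** The exception for [set0] handles the complex whose only facet is [set0]: otherwise no set would
    qualify, and every single dot would be a minimal illegal position. *)
Definition facet_free : {set {set V}} :=
  [set s : {set V} | [forall t in facets D, (t \subset s) ==> (t == set0)]].

Lemma facet_free_closed (s t : {set V}) :
  s \in facet_free -> t \subset s -> t \in facet_free.
Proof.
rewrite !inE => /forall_inP fs ts; apply/forall_inP=> u /fs /implyP us.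
by apply/implyP=> ut; apply/us/(subset_trans ut).
Qed.

Definition facet_free_complex : complex V := Complex facet_free_closed.

Lemma notin_facet_free (s : {set V}) :
  reflect (exists t, [/\ t \in facets D, t \subset s & t != set0])
    (s \notin facet_free).
Proof.
rewrite inE negb_forall_in; apply: (iffP exists_inP) => [[t tF] | [t [tF ts t0]]].
  by rewrite negb_imply => /andP[ts t0]; exists t.
by exists t => //; rewrite negb_imply ts.
Qed.

Lemma facet_face (t : {set V}) : t \in facets D -> t \in faces D.
Proof. by rewrite inE => /maxsetP[]. Qed.

Lemma facet_max (s t : {set V}) :
  s \in facets D -> t \in faces D -> s \subset t -> t = s.
Proof. by rewrite inE => /maxsetP[_ smax] tD; apply: smax. Qed.

Lemma face_sub_facet (s : {set V}) :
  s \in faces D -> exists2 t, t \in facets D & s \subset t.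
Proof.
move=> sD; have [t tmax st] := @maxset_exists _ [pred t in faces D] s sD.
by exists t => //; rewrite inE.
Qed.

Context (L : {set V}).

Let G := dot_game L facet_free_complex.

Lemma illegal_dot (P : position G) :
  reflect (exists t, [/\ t \in facets D, @dot V L @: t \subset P & t != set0])
    (~~ legal P).
Proof.
rewrite legal_dot negb_or; apply: (iffP andP).
  case=> _ /notin_facet_free[t [tF tP t0]]; exists t; split=> //.
  by rewrite -[P]undot_imK imsetS.
case=> t [tF tP t0]; split.
  by apply: contraNneq t0 => P0; rewrite P0 subset0 imset_eq0 in tP.
apply/notin_facet_free; exists t; split=> //.
by rewrite -[t](dot_imK L) imsetS.
Qed.

Lemma dot_illegal_complex : same_complex (@dot V L) D (illegal_complex G).
Proof.
move=> s s0; rewrite inE; apply/idP/exists_inP.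
  move=> /face_sub_facet[t tF st]; exists (@dot V L @: t); last exact: imsetS.
  have t0 : t != set0 by apply: contraNneq s0 => t0; rewrite -subset0 -t0.
  rewrite inE; apply/minsetP; split; first by apply/illegal_dot; exists t.
  (* An illegal [P] inside the image of [t] contains the image of a facet [u]; then [u] lies in [t],
     and maximality of [u] gives [t = u]. *)
  move=> P /illegal_dot[u [uF uP _]] Pt; apply/eqP; rewrite eqEsubset Pt /=.
  have ut : u \subset t.
    by rewrite -[u](dot_imK L) -[t](dot_imK L) imsetS // (subset_trans uP Pt).
  by rewrite (facet_max uF (facet_face tF) ut).
case=> P; rewrite inE => /minsetP[/illegal_dot[t [tF tP t0]] minP] sP.
(* The image of [t] is itself illegal and lies in [P], so minimality of [P] forces equality. *)
have tE : @dot V L @: t = P.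
  by apply: minP => //; apply/illegal_dot; exists t.
apply: faces_closed (facet_face tF) _.
by rewrite -[s](dot_imK L) -[t](dot_imK L) imsetS // tE.
Qed.

End NonFacets.

Theorem proposition1p18 (V : finType) (D : complex V) (L R : {set V})
    (LR_cover : L :|: R = setT) (LR_disjoint : [disjoint L & R]) :
  exists (B : board) (G1 G2 : sp_game B),
    is_game_complex D L R (legal_complex G1) /\
    is_game_complex D L R (illegal_complex G2).
Proof.
(* [dot_pieces] gives every vertex outside [L] to Right. *)
have -> : R = ~: L.
  apply/setP=> x; rewrite inE; have := in_setT x; rewrite -LR_cover inE.
  by case: (boolP (x \in L)) => //= xL _; rewrite (disjointFr LR_disjoint xL).
exists (dot_board V), (dot_game L D), (dot_game L (facet_free_complex D)).
split; exists (@dot V L); split; do ?[exact: dot_bij | exact: dot_left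
  | exact: dot_right].
  exact: dot_legal_complex.
exact: dot_illegal_complex.
Qed.
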